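(* Suppose the data assumptions, the network connectivity assumption, the weight assumption and the assumption on the numbers of gossip exchanges (for some $\xi\in(0,1/2)$), all stated in the context, hold, and that all agents use the same initial point $\mathbf{x}_i^0=\mathbf{x}^0$. Then the discrepancy between the inexact and the exact descent directions in the Gossip-based Gauss-Newton algorithm satisfies, for all agents $i$ and all $k\ge 0$, $$\|\mathbf{d}_i^k(\ell_k)-\mathbf{d}_i^k\|<\kappa,\qquad \kappa\triangleq 4C_1D\lambda_\eta^{\ell_{\min}+1},$$ and the magnitude of $\kappa$ vanishes exponentially with the minimum number of gossip exchanges $\ell_{\min}$; that is, $\lim_{\ell_{\min}\to\infty}\kappa=0$ (with $D$ held fixed).
   Context: Norms of vectors are Euclidean and norms of matrices are spectral norms. Problem data. $\mathbb{X}\subset\mathbb{R}^N$ is a compact convex set and $P_{\mathbb{X}}$ is the Euclidean projection onto $\mathbb{X}$. $\mathbf{g}:\mathbb{R}^N\to\mathbb{R}^M$ is continuously differentiable with $M\times N$ Jacobian $\mathbf{G}(\mathbf{x})=\partial\mathbf{g}(\mathbf{x})/\partial\mathbf{x}^T$, and is split among $I\ge2$ agents as $\mathbf{g}=[\mathbf{g}_1^T,\dots,\mathbf{g}_I^T]^T$, $\mathbf{g}_i:\mathbb{R}^N\to\mathbb{R}^{M_i}$, $\sum_iM_i=M$, with $\mathbf{G}_i(\mathbf{x})=\partial\mathbf{g}_i(\mathbf{x})/\partial\mathbf{x}^T$. Data assumptions. (1) $\|\mathbf{g}(\mathbf{x})\|\le\epsilon_{\max}$ for $\mathbf{x}\in\mathbb{X}$.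 (2) $\mathbf{G}(\mathbf{x})$ has full column rank for all $\mathbf{x}\in\mathbb{X}$, and with $\sigma_{\min}=\min_{\mathbf{x}\in\mathbb{X}}\sqrt{\lambda_{\min}(\mathbf{G}^T(\mathbf{x})\mathbf{G}(\mathbf{x}))}$ and $\sigma_{\max}=\max_{\mathbf{x}\in\mathbb{X}}\sqrt{\lambda_{\max}(\mathbf{G}^T(\mathbf{x})\mathbf{G}(\mathbf{x}))}$ one has $0<\sigma_{\min}\le\sigma_{\max}<\infty$. (3) $\|\mathbf{G}(\mathbf{x})-\mathbf{G}(\mathbf{x}')\|\le\omega\|\mathbf{x}-\mathbf{x}'\|$ for all $\mathbf{x},\mathbf{x}'\in\mathbb{X}$, with $\omega>0$. Let $\nu_\delta\ge\omega(\epsilon_{\max}+\sigma_{\max})$ and $\nu_\Delta\ge2\sigma_{\max}\omega$ be Lipschitz constants such that for all $i$ and all $\mathbf{x},\mathbf{x}'\in\mathbb{X}$: $\|\mathbf{G}_i^T(\mathbf{x})\mathbf{g}_i(\mathbf{x})-\mathbf{G}_i^T(\mathbf{x}')\mathbf{g}_i(\mathbf{x}')\|\le\nu_\delta\|\mathbf{x}-\mathbf{x}'\|$ and $\|\mathbf{G}_i^T(\mathbf{x})\mathbf{G}_i(\mathbf{x})-\mathbf{G}_i^T(\mathbf{x}')\mathbf{G}_i(\mathbf{x}')\|\le\nu_\Delta\|\mathbf{x}-\mathbf{x}'\|$. Put $\nu=\max\{\nu_\delta,\nu_\Delta\}$. Gossip-based Gauss-Newton (GGN) algorithm with constant step-size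 $\alpha\in(0,1]$. Each agent $i$ holds an iterate $\mathbf{x}_i^k\in\mathbb{X}$, $k=0,1,2,\dots$, starting from $\mathbf{x}_i^0\in\mathbb{X}$. For update $k$, agent $i$ sets $\mathbf{h}_{k,i}(0)=\mathbf{G}_i^T(\mathbf{x}_i^k)\mathbf{g}_i(\mathbf{x}_i^k)$ and $\mathbf{H}_{k,i}(0)=\mathbf{G}_i^T(\mathbf{x}_i^k)\mathbf{G}_i(\mathbf{x}_i^k)$. Then $\ell_k$ gossip exchanges with $I\times I$ weight matrices $\mathbf{W}_k(\ell)=[W^k_{ij}(\ell)]$ are performed: for $1\le\ell\le\ell_k$, $\mathbf{h}_{k,i}(\ell)=\sum_jW^k_{ij}(\ell)\mathbf{h}_{k,j}(\ell-1)$ and $\mathbf{H}_{k,i}(\ell)=\sum_jW^k_{ij}(\ell)\mathbf{H}_{k,j}(\ell-1)$. The inexact descent is $\mathbf{d}_i^k(\ell_k)=\mathbf{H}_{k,i}^{-1}(\ell_k)\mathbf{h}_{k,i}(\ell_k)$ (the inverses appearing in the algorithm are implicitly understood to exist), and the update is $\mathbf{x}_i^{k+1}=P_{\mathbb{X}}[\mathbf{x}_i^k-\alpha\mathbf{d}_i^k(\ell_k)]$. The exact descent is $\mathbf{d}_i^k=[\mathbf{G}^T(\mathbf{x}_i^k)\mathbf{G}(\mathbf{x}_i^k)]^{-1}\mathbf{G}^T(\mathbf{x}_i^k)\mathbf{g}(\mathbf{x}_i^k)$. Network connectivity assumption. For each $k$ and each exchange $\ell\ge1$ there is an undirected graph on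 $\{1,\dots,I\}$ with edge set $\mathcal{M}_{k,\ell}$. Let $\mathcal{M}_{k,\infty}$ be the set of pairs $\{i,j\}$ belonging to $\mathcal{M}_{k,\ell}$ for infinitely many $\ell$. For each $k$ the graph $(\{1,\dots,I\},\mathcal{M}_{k,\infty})$ is connected, and there is an integer $L\ge1$ such that for every $k$, every $\ell$ and every $\{i,j\}\in\mathcal{M}_{k,\infty}$, $\{i,j\}\in\bigcup_{\ell'=0}^{L-1}\mathcal{M}_{k,\ell+\ell'}$. Weight assumption. All $\mathbf{W}_k(\ell)$ are symmetric and doubly stochastic, and there is $\eta\in(0,1)$ such that for all $k,\ell$ and all $i\ne j$: $W^k_{ii}(\ell)\ge\eta$; $W^k_{ij}(\ell)\ge\eta$ if $\{i,j\}\in\mathcal{M}_{k,\ell}$; $W^k_{ij}(\ell)=0$ if $\{i,j\}\notin\mathcal{M}_{k,\ell}$. Constants. $L_0=(I-1)L$, $\lambda_\eta=(1-\eta^{L_0})^{1/L_0}\in(0,1)$, $$C=2I\sigma_{\max}\sqrt{I(\epsilon_{\max}^2+N\sigma_{\max}^2)}\left(\frac{1+\eta^{-L_0}}{1-\eta^{L_0}}\right),\quad C_1=2\left(1+\frac{\sigma_{\max}\epsilon_{\max}}{\sigma_{\min}^2}\right),\quad C_2=\frac{I}{\sigma_{\min}^2}.$$ Assumption on the numbers of exchanges. With $\ell_{\min}=\min_k\ell_k$, the sequence $\{\ell_k\}_{k\ge0}$ satisfies $\lambda_\infty:=\lim_{K\to\infty}\sum_{k=0}^K\lambda_\eta^{\ell_k-\ell_{\min}}<\infty$,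 and, for the given $\xi\in(0,1/2)$, $$\ell_{\min}=\left\lceil\frac{\log(\xi/(4D))}{\log\lambda_\eta}\right\rceil,\qquad D=CC_2(\nu\lambda_\infty C_1C_2+1).$$ *)

(* Defs.v *)
From HB Require Import structures.
From mathcomp Require Import all_boot all_order all_algebra.
From mathcomp Require Import all_classical all_reals all_analysis.

Set Implicit Arguments.
Unset Strict Implicit.
Unset Printing Implicit Defensive.

Import Order.TTheory GRing.Theory Num.Theory.
Import numFieldNormedType.Exports.

Local Open Scope classical_set_scope.
Local Open Scope ring_scope.

(* The library norm `|_| on matrices is the max-norm, hence the definitions of
   the Euclidean norm [enorm] and of the spectral norm [specnorm]. *)
Definition enorm (R : realType) (n : nat) (v : 'cV[R]_n) : R :=
  Num.sqrt (\sum_(i < n) v i 0 ^+ 2).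

(* Only used on symmetric matrices of size n > 0, whose spectrum is finite,
   nonempty and real, so that sup and inf are a max and a min. *)
Definition lambda_max (R : realType) (n : nat) (A : 'M[R]_n) : R :=
  sup [set a | eigenvalue A a].

Definition lambda_min (R : realType) (n : nat) (A : 'M[R]_n) : R :=
  inf [set a | eigenvalue A a].

Definition specnorm (R : realType) (m n : nat) (A : 'M[R]_(m, n)) : R :=
  Num.sqrt (lambda_max (A^T *m A)).

Definition is_min (S : Type) (d : Order.disp_t) (T : porderType d)
    (A : set S) (f : S -> T) (m : T) : Prop :=
  (exists2 x, A x & f x = m) /\ (forall x, A x -> (m <= f x)%O).

Definition is_max (S : Type) (d : Order.disp_t) (T : porderType d)
    (A : set S) (f : S -> T) (m : T) : Prop :=
  (exists2 x, A x & f x = m) /\ (forall x, A x -> (f x <= m)%O).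

(* [get] selects the (unique, when X is nonempty, closed and convex) point of X
   nearest to y. *)
Definition proj (R : realType) (n : nat) (X : set 'cV[R]_n) (y : 'cV[R]_n) :
    'cV[R]_n :=
  get [set p | X p /\ forall z, X z -> enorm (y - p) <= enorm (y - z)].

(* The m x n Jacobian of f.  The library's [jacobian] is stated for row vectors
   and acts on them from the right, hence the transpositions. *)
Definition jac (R : realType) (n m : nat) (f : 'cV[R]_n -> 'cV[R]_m)
    (x : 'cV[R]_n) : 'M[R]_(m, n) :=
  (jacobian (fun u : 'rV[R]_n => (f u^T)^T) x^T)^T.

Section Algorithm.
Context (R : realType) (nag N : nat) (Ms : 'I_nag -> nat).
Implicit Types (g : 'cV[R]_N -> 'cV[R]_(\sum_i Ms i)) (X : set 'cV[R]_N).
Implicit Types (W : nat -> 'M[R]_nag) (x : 'I_nag -> 'cV[R]_N).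

(* The i-th block g_i of g = [g_1; ...; g_I], of height M_i. *)
Definition agent_map g (i : 'I_nag) (y : 'cV[R]_N) : 'cV[R]_(Ms i) :=
  submxcol (g y) i.

Definition agent_grad g (i : 'I_nag) (y : 'cV[R]_N) : 'cV[R]_N :=
  (jac (agent_map g i) y)^T *m agent_map g i y.

Definition agent_gram g (i : 'I_nag) (y : 'cV[R]_N) : 'M[R]_N :=
  (jac (agent_map g i) y)^T *m jac (agent_map g i) y.

(* Agents' values after l exchanges; exchange number l >= 1 uses W l, and W 0
   is never used. *)
Fixpoint gossip (V : lmodType R) W (v : 'I_nag -> V) (l : nat) : 'I_nag -> V :=
  if l is l'.+1 then fun i => \sum_(j < nag) W l i j *: gossip W v l' j else v.

Definition gossip_h g W x (l : nat) : 'I_nag -> 'cV[R]_N :=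
  gossip W (fun j => agent_grad g j (x j)) l.

Definition gossip_H g W x (l : nat) : 'I_nag -> 'M[R]_N :=
  gossip W (fun j => agent_gram g j (x j)) l.

Definition inexact_descent g W x (l : nat) (i : 'I_nag) : 'cV[R]_N :=
  invmx (gossip_H g W x l i) *m gossip_h g W x l i.

Definition exact_descent g (y : 'cV[R]_N) : 'cV[R]_N :=
  invmx ((jac g y)^T *m jac g y) *m ((jac g y)^T *m g y).

Fixpoint ggn_iter (alpha : R) X g (W : nat -> nat -> 'M[R]_nag)
    (ell : nat -> nat) (xinit : 'I_nag -> 'cV[R]_N) (k : nat) :
    'I_nag -> 'cV[R]_N :=
  if k is k'.+1 then
    let x := ggn_iter alpha X g W ell xinit k' in
    fun i => proj X (x i - alpha *: inexact_descent g (W k') x (ell k') i)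
  else xinit.

End Algorithm.

Section Network.
Context (R : realType) (nag : nat).

(* [E k l] is the adjacency relation of the graph used for exchange l >= 1 of
   update k. *)
Implicit Types (E : nat -> nat -> rel 'I_nag).

Definition recurrent_edge E (k : nat) : rel 'I_nag :=
  fun i j => `[< forall l0 : nat, exists2 l, (l0 < l)%N & E k l i j >].

Definition network_connectivity E (L : nat) : Prop :=
  [/\ forall k l, (0 < l)%N -> symmetric (E k l) /\ irreflexive (E k l),
      forall k i j, connect (recurrent_edge E k) i j,
      (0 < L)%N
    & forall k l i j, (0 < l)%N -> recurrent_edge E k i j ->
        exists2 l', (l' < L)%N & E k (l + l')%N i j].

Definition doubly_stochastic (A : 'M[R]_nag) : Prop :=
  [/\ forall i j, 0 <= A i j,
      forall i, \sum_(j < nag) A i j = 1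
    & forall j, \sum_(i < nag) A i j = 1].

Definition weight_assumption E (eta : R) (W : nat -> nat -> 'M[R]_nag) : Prop :=
  [/\ 0 < eta < 1,
      forall k l, (0 < l)%N -> (W k l)^T = W k l /\ doubly_stochastic (W k l),
      forall k l i, (0 < l)%N -> eta <= W k l i i
    & forall k l i j, (0 < l)%N -> i != j ->
        (E k l i j -> eta <= W k l i j) /\ (~~ E k l i j -> W k l i j = 0)].

End Network.

Definition kappa (R : realType) (C1 D lam : R) (l : nat) : R :=
  4 * C1 * D * lam ^+ l.+1.

(* Main.v *)
Require Import Defs.
From HB Require Import structures.
From mathcomp Require Import all_boot all_order all_algebra.
From mathcomp Require Import all_classical all_reals all_analysis.
From mathcomp Require Import ring lra.

Set Implicit Arguments.
Unset Strict Implicit.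
Unset Printing Implicit Defensive.

Import Order.TTheory GRing.Theory Num.Theory.
Import numFieldNormedType.Exports.

Local Open Scope classical_set_scope.
Local Open Scope ring_scope.

(** Why the theorem is true.

    Gossip.  The edges that recur connect all the agents, and each of them is
    active within any [L] exchanges, so over [L0 = (nag - 1) * L] exchanges
    every agent gives weight at least [eta ^+ L0] to every other one
    ([transition_positive]).  The range of each column of the transition matrix
    therefore shrinks by [1 - eta ^+ L0] every [L0] exchanges
    ([average_spread]), and after [l] exchanges the agents hold the average of
    the initial data up to an error of order [lam ^+ l.+1]
    ([gossip_deviation]).

    One update.  If the iterates disagree by at most [r], the averaged system
    is within [nu * r] of the exact Gauss-Newton system of each agent, and the
    system that the agent solves is within the gossip error [p] of the averaged
    one.  The exact system is bounded below by [C2^-1], so perturbation of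
    linear systems yields [C1 * C2 * (p + nu * r)] as error on the descent
    direction ([descent_error]).

    Disagreement.  Comparing the descents of two agents directly, through the
    averaged system, only costs a multiple of [p] ([descent_disagreement]): the
    disagreement [r] does not feed on itself.  The projection is nonexpansive
    ([proj_nonexpansive]), so from a common initial point the disagreement is
    at most a multiple of the sum of the gossip errors, which [lam_inf]
    controls.  Hence [C2 * (p + nu * r) <= D * lam ^+ ell_min.+1] at every
    update, the choice of [ell_min] keeps this below [1 / 8], as the
    perturbation argument demands, and the error is at most
    [C1 * D * lam ^+ ell_min.+1].

    The spectral data enter through Rayleigh quotients: the extreme eigenvalues
    of a symmetric matrix bound its quadratic form
    ([rayleigh_min_eigenvalue]). *)

(** * Euclidean geometry *)

Definition dot (R : realType) (n : nat) (u v : 'cV[R]_n) : R :=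
  (u^T *m v) 0 0.

Section Euclidean.
Context (R : realType).

Lemma dotDl n (u v w : 'cV[R]_n) : dot (u + v) w = dot u w + dot v w.
Proof. by rewrite /dot raddfD mulmxDl mxE. Qed.

Lemma dotDr n (u v w : 'cV[R]_n) : dot w (u + v) = dot w u + dot w v.
Proof. by rewrite /dot mulmxDr mxE. Qed.

Lemma dotZl n a (u v : 'cV[R]_n) : dot (a *: u) v = a * dot u v.
Proof. by rewrite /dot linearZ -scalemxAl mxE. Qed.

Lemma dotZr n a (u v : 'cV[R]_n) : dot u (a *: v) = a * dot u v.
Proof. by rewrite /dot -scalemxAr mxE. Qed.

Lemma dotNl n (u v : 'cV[R]_n) : dot (- u) v = - dot u v.
Proof. by rewrite -scaleN1r dotZl mulN1r. Qed.

Lemma dotNr n (u v : 'cV[R]_n) : dot u (- v) = - dot u v.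
Proof. by rewrite -scaleN1r dotZr mulN1r. Qed.

Lemma dotC n (u v : 'cV[R]_n) : dot u v = dot v u.
Proof. by rewrite /dot !mxE; apply: eq_bigr => i _; rewrite !mxE mulrC. Qed.

Lemma dot_mulmxr m n (A : 'M[R]_(m, n)) u v :
  dot u (A *m v) = dot (A^T *m u) v.
Proof. by rewrite /dot trmx_mul trmxK mulmxA. Qed.

Lemma dot_sqr n (u : 'cV[R]_n) : dot u u = \sum_(i < n) u i 0 ^+ 2.
Proof. by rewrite /dot mxE; apply: eq_bigr => i _; rewrite !mxE expr2. Qed.

Lemma enorm_ge0 n (u : 'cV[R]_n) : 0 <= enorm u.
Proof. exact: sqrtr_ge0. Qed.

Lemma enorm_sqr n (u : 'cV[R]_n) : enorm u ^+ 2 = dot u u.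
Proof.
by rewrite dot_sqr sqr_sqrtr //; apply: sumr_ge0 => i _; exact: sqr_ge0.
Qed.

Lemma dot_ge0 n (u : 'cV[R]_n) : 0 <= dot u u.
Proof. by rewrite -enorm_sqr sqr_ge0. Qed.

Lemma enorm0_eq0 n (u : 'cV[R]_n) : enorm u = 0 -> u = 0.
Proof.
move=> u0; have := enorm_sqr u; rewrite u0 expr0n /= dot_sqr => /esym/eqP.
rewrite psumr_eq0; last by move=> i _; exact: sqr_ge0.
move=> /allP z; apply/colP => i; rewrite mxE; apply/eqP.
by rewrite -sqrf_eq0; apply: z; rewrite mem_index_enum.
Qed.

Lemma enorm_gt0 n (u : 'cV[R]_n) : u != 0 -> 0 < enorm u.
Proof.
by move=> u0; rewrite lt0r enorm_ge0 andbT; apply: contra_neq u0 => /enorm0_eq0.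
Qed.

Lemma enormN n (u : 'cV[R]_n) : enorm (- u) = enorm u.
Proof. by rewrite /enorm; congr Num.sqrt; apply: eq_bigr => i _; rewrite mxE sqrrN. Qed.

Lemma enormBC n (u v : 'cV[R]_n) : enorm (u - v) = enorm (v - u).
Proof. by rewrite -enormN opprB. Qed.

Lemma enormZ n a (u : 'cV[R]_n) : enorm (a *: u) = `|a| * enorm u.
Proof.
apply/eqP; rewrite -(eqrXn2 (n := 2)) ?mulr_ge0 ?enorm_ge0 //.
by rewrite exprMn !enorm_sqr dotZl dotZr real_normK ?num_real // mulrA expr2.
Qed.

Lemma enorm0 n : enorm (0 : 'cV[R]_n) = 0.
Proof. by rewrite -(scale0r 0) enormZ normr0 mul0r. Qed.

Lemma dot_le_enorm n (u v : 'cV[R]_n) : dot u v <= enorm u * enorm v.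
Proof.
have [->|u0] := eqVneq u 0.
  by rewrite enorm0 mul0r /dot linear0 mul0mx mxE.
have [->|v0] := eqVneq v 0.
  by rewrite enorm0 mulr0 /dot mulmx0 mxE.
have p : 0 < enorm u * enorm v by rewrite mulr_gt0 ?enorm_gt0.
have := dot_ge0 (enorm v *: u - enorm u *: v).
rewrite !(dotDl, dotDr, dotNl, dotNr, dotZl, dotZr) -!enorm_sqr (dotC v u).
move=> h; rewrite -(ler_pM2l p) -subr_ge0.
rewrite -(pmulr_rge0 _ (ltr0Sn R 1)); apply: le_trans h _.
by rewrite le_eqVlt; apply/orP; left; apply/eqP; ring.
Qed.

Lemma enormD n (u v : 'cV[R]_n) : enorm (u + v) <= enorm u + enorm v.
Proof.
rewrite -(ler_pXn2r (n := 2)) ?nnegrE ?addr_ge0 ?enorm_ge0 //.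
rewrite sqrrD !enorm_sqr !(dotDl, dotDr) (dotC v u).
have := dot_le_enorm u v; lra.
Qed.

Lemma enormB n (u v : 'cV[R]_n) : enorm (u - v) <= enorm u + enorm v.
Proof. by rewrite -(enormN v) enormD. Qed.

Lemma enorm_sum (I : finType) n (f : I -> 'cV[R]_n) :
  enorm (\sum_i f i) <= \sum_i enorm (f i).
Proof.
elim/big_ind2: _ => [|u a v b ua vb|//]; first by rewrite enorm0.
by apply: le_trans (enormD _ _) _; exact: lerD.
Qed.

(** [enorm (A^T *m w) ^+ 2 = dot w (A *m (A^T *m w))], so the bound on [A]
    can be used on the vector [A^T *m w]. *)
Lemma enorm_trmx_le m n (A : 'M[R]_(m, n)) s : 0 <= s ->
  (forall v, enorm (A *m v) <= s * enorm v) ->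
  forall w, enorm (A^T *m w) <= s * enorm w.
Proof.
move=> s0 As w; have [->|Aw0] := eqVneq (A^T *m w) 0.
  by rewrite enorm0 mulr_ge0 ?enorm_ge0.
rewrite -(ler_pM2l (enorm_gt0 Aw0)) -expr2 enorm_sqr -dot_mulmxr.
rewrite (le_trans (dot_le_enorm _ _)) // mulrC [leRHS]mulrA.
by rewrite [_ * s]mulrC ler_wpM2r ?enorm_ge0 // As.
Qed.

(** This is how a first-order condition is read off from the comparison of a
    linear term in [t] with a quadratic one, after division by [t]. *)
Lemma first_order_le0 (a c : R) :
  (forall t, 0 < t <= 1 -> a <= t * c) -> a <= 0.
Proof.
move=> h; rewrite leNgt; apply/negP => a0.
have ac : a <= c by have := h 1; rewrite mul1r ltr01 lexx; apply.
have c0 : 0 < c by apply: lt_le_trans ac.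
have : a <= a / (2 * c) * c.
  apply: h; rewrite divr_gt0 ?mulr_gt0 //= ler_pdivrMr ?mulr_gt0 //; lra.
have -> : a / (2 * c) * c = a / 2 by field; apply: lt0r_neq0.
lra.
Qed.

Lemma quadratic_form_continuous n (A : 'M[R]_n) :
  continuous (fun v : 'cV[R]_n => dot v (A *m v)).
Proof.
have cs k (f : 'I_k -> 'cV[R]_n -> R) :
    (forall i, continuous (f i)) -> continuous (fun v => \sum_i f i v).
  by move=> cf v; apply: (cvg_big add_continuous (nbhs_filter v)) => i _; exact: cf.
have E : (fun v : 'cV[R]_n => \sum_i (v i 0 * \sum_j (A i j * v j 0))) =
         (fun v : 'cV[R]_n => dot v (A *m v)).
  apply: funext => w; rewrite /dot mxE; apply: eq_bigr => i _.
  by rewrite !mxE.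
rewrite -E.
apply: (cs n (fun i (v : 'cV[R]_n) => v i 0 * \sum_j (A i j * v j 0))) => i v.
apply: continuousM; first exact: coord_continuous.
apply: (cs n (fun j (v : 'cV[R]_n) => A i j * v j 0)) => j {}v.
apply: continuousM; first exact: cst_continuous.
exact: coord_continuous.
Qed.

Lemma enorm_continuous n : continuous (@enorm R n).
Proof.
have E : (@Num.sqrt R) \o (fun v : 'cV[R]_n => dot v (1%:M *m v)) = @enorm R n.
  by apply/funext => v; rewrite /= mul1mx dot_sqr.
rewrite -E => v.
apply: continuous_comp; first exact: quadratic_form_continuous.
exact: sqrt_continuous.
Qed.

(** Covers transposition and the extraction of a block. *)
Lemma reindex_mx_continuous m n p q (f : 'M[R]_(m, n) -> 'M[R]_(p, q))
    (s : 'I_p -> 'I_q -> 'I_m) (t : 'I_p -> 'I_q -> 'I_n) :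
  (forall M i j, f M i j = M (s i j) (t i j)) -> continuous f.
Proof.
move=> fE M B /nbhs_ballP[e e0 eB]; apply/nbhs_ballP; exists e => // M' [_ MM'].
by apply: eB; split => // i j; rewrite !fE; exact: MM'.
Qed.

End Euclidean.

(** * Rayleigh quotients and operator bounds *)

Section Rayleigh.
Context (R : realType).

Lemma unit_sphere_compact n : compact [set v : 'cV[R]_n | enorm v = 1].
Proof.
have -> : [set v : 'cV[R]_n | enorm v = 1] =
          trmx @` [set v : 'rV[R]_n | enorm v^T = 1].
  apply/seteqP; split => [v v1|_ [v v1 <-] //].
  by exists v^T; rewrite /= trmxK.
have ct m k : continuous (@trmx R m k).
  by apply: (reindex_mx_continuous (s := fun i j => j) (t := fun i j => i)) => M i j;
     rewrite mxE.
apply: continuous_compact; first by apply: continuous_subspaceT; exact: ct.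
apply: bounded_closed_compact.
  exists 1; split => // M M1 v /= v1; apply: le_trans (ltW M1).
  rewrite [leLHS]/Num.norm /= mx_normrE; apply/bigmax_leP; split => //; case=> i j _ /=.
  rewrite -(ler_pXn2r (n := 2)) ?nnegrE // real_normK ?num_real //.
  rewrite expr1n -(expr1n R 2) -v1 enorm_sqr dot_sqr (bigD1 j) //= mxE ord1.
  by rewrite lerDl; apply: sumr_ge0 => k _; exact: sqr_ge0.
apply: (@preimage_closed _ _ (fun v : 'rV[R]_n => enorm v^T) [set 1]).
  by move=> v _; apply: continuous_comp; [exact: ct|exact: enorm_continuous].
exact: closed_eq.
Qed.

(** The minimum [m] of the Rayleigh quotient is attained on the unit sphere,
    by compactness.  At a minimiser [c] the positive semidefinite form of
    [A - m] vanishes, so [(A - m) c = 0]: otherwise moving from [c] a little in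
    the direction opposite to [(A - m) c] would make the form negative. *)
Lemma rayleigh_min_eigenvalue n (A : 'M[R]_n) : (0 < n)%N -> A^T = A ->
  exists2 m, eigenvalue A m & forall v, m * dot v v <= dot v (A *m v).
Proof.
move=> n0 symA.
have S0 : [set v : 'cV[R]_n | enorm v = 1] !=set0.
  exists (delta_mx (Ordinal n0) 0) => /=.
  rewrite /enorm (bigD1 (Ordinal n0)) //= big1 => [|i ni].
    by rewrite mxE !eqxx expr1n addr0 sqrtr1.
  by rewrite mxE (negbTE ni) /= expr0n.
have [c] := compact_EVT_min S0 (@unit_sphere_compact n)
  (continuous_subspaceT (@quadratic_form_continuous R n A)).
rewrite inE /= => c1 cmin; set m := dot c (A *m c).
have mle v : m * dot v v <= dot v (A *m v).
  have [->|v0] := eqVneq v 0; first by rewrite /dot !mulmx0 mxE mulr0.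
  have vp := enorm_gt0 v0.
  have := cmin ((enorm v)^-1 *: v); rewrite inE /= enormZ.
  rewrite gtr0_norm ?invr_gt0 // mulVf ?gt_eqF // => /(_ erefl).
  rewrite -/m -scalemxAr dotZl dotZr mulrA -expr2 exprVn mulrC.
  by rewrite ler_pdivlMr ?exprn_gt0 // enorm_sqr.
exists m => //; pose B := A - m%:M.
have Bpos v : 0 <= dot v (B *m v).
  by rewrite mulmxBl mul_scalar_mx dotDr dotNr dotZr subr_ge0.
have symB : B^T = B by rewrite /B linearB /= tr_scalar_mx symA.
have Bc0 : B *m c = 0.
  apply/enorm0_eq0/eqP; rewrite -sqrf_eq0 eq_le sqr_ge0 andbT.
  have : 2 * enorm (B *m c) ^+ 2 <= 0; last by rewrite pmulr_rle0.
  apply: (first_order_le0 (c := dot (B *m c) (B *m (B *m c)))) => t /andP[t0 _].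
  rewrite -(ler_pM2l t0) -subr_ge0.
  have := Bpos (c - t *: (B *m c)); rewrite mulmxBr -scalemxAr.
  rewrite !(dotDl, dotDr, dotNl, dotNr, dotZl, dotZr).
  rewrite (dot_mulmxr B c (B *m c)) symB -enorm_sqr.
  have -> : dot c (B *m c) = 0.
    rewrite mulmxBl mul_scalar_mx dotDr dotNr dotZr -enorm_sqr c1 expr1n mulr1.
    by rewrite subrr.
  by move=> /le_trans; apply; rewrite le_eqVlt; apply/orP; left; apply/eqP; ring.
apply/eigenvalueP; exists c^T; last first.
  apply: contra_eq_neq c1 => /(congr1 trmx); rewrite trmxK trmx0 => ->.
  by rewrite enorm0 eq_sym oner_neq0.
apply: trmx_inj; rewrite trmx_mul trmxK linearZ /= trmxK symA.
by apply/eqP; rewrite -subr_eq0 -mul_scalar_mx -mulmxBl Bc0.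
Qed.

Lemma eigenvalue_ge n (A : 'M[R]_n) m a :
  (forall v, m * dot v v <= dot v (A *m v)) -> eigenvalue A a -> m <= a.
Proof.
move=> mle /eigenvalueP[v vA v0].
have p : 0 < dot v^T v^T.
  rewrite -enorm_sqr exprn_gt0 // enorm_gt0 //; apply: contra_neq v0.
  by move=> /(congr1 trmx); rewrite trmxK trmx0.
rewrite -(ler_pM2r p); apply: le_trans (mle _) _.
by rewrite dot_mulmxr -trmx_mul vA linearZ /= dotZl.
Qed.

Lemma lambda_min_le n (A : 'M[R]_n) v : (0 < n)%N -> A^T = A ->
  lambda_min A * dot v v <= dot v (A *m v).
Proof.
move=> n0 symA; have [m Am mle] := rayleigh_min_eigenvalue n0 symA.
apply: le_trans (mle v); rewrite ler_wpM2r ?dot_ge0 //.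
apply: ge_inf => //; exists m => a /= Aa.
exact: eigenvalue_ge mle Aa.
Qed.

Lemma le_lambda_max n (A : 'M[R]_n) v : (0 < n)%N -> A^T = A ->
  dot v (A *m v) <= lambda_max A * dot v v.
Proof.
move=> n0 symA; have symNA : (- A)^T = - A by rewrite linearN /= symA.
have NA a : eigenvalue (- A) a = eigenvalue A (- a).
  apply/eigenvalueP/eigenvalueP => -[w wA w0]; exists w => //.
    by rewrite scaleNr -wA mulmxN opprK.
  by rewrite mulmxN wA scaleNr opprK.
have [m Am mle] := rayleigh_min_eigenvalue n0 symNA.
have : dot v (A *m v) <= - m * dot v v.
  by rewrite mulNr lerNr -dotNr -mulNmx.
move=> /le_trans; apply; rewrite ler_wpM2r ?dot_ge0 //.
apply: ub_le_sup; last by rewrite /= -NA.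
exists (- m) => a /= Aa; rewrite lerNr; apply: eigenvalue_ge mle _.
by rewrite NA opprK.
Qed.

Lemma enorm_mulmx_le m n (A : 'M[R]_(m, n)) s v : (0 < n)%N ->
  Num.sqrt (lambda_max (A^T *m A)) <= s -> enorm (A *m v) <= s * enorm v.
Proof.
move=> n0 As; have s0 : 0 <= s := le_trans (sqrtr_ge0 _) As.
rewrite -(ler_pXn2r (n := 2)) ?nnegrE ?mulr_ge0 ?enorm_ge0 //.
rewrite exprMn !enorm_sqr dot_mulmxr dotC mulmxA.
have symA : (A^T *m A)^T = A^T *m A by rewrite trmx_mul trmxK.
apply: le_trans (le_lambda_max _ n0 symA) _; rewrite ler_wpM2r ?dot_ge0 //.
have [l0|l0] := ltP (lambda_max (A^T *m A)) 0.
  by rewrite (le_trans (ltW l0)) ?sqr_ge0.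
by rewrite -(sqr_sqrtr l0) ler_pXn2r ?nnegrE ?sqrtr_ge0.
Qed.

Lemma enorm_mulmx_specnorm m n (A : 'M[R]_(m, n)) v : (0 < n)%N ->
  enorm (A *m v) <= specnorm A * enorm v.
Proof. by move=> n0; exact: enorm_mulmx_le. Qed.

(** Cauchy-Schwarz turns the bound on the quadratic form of [A^T *m A] into a
    bound on the vector [A^T *m A *m v]. *)
Lemma enorm_gram_ge m n (A : 'M[R]_(m, n)) s v : (0 < n)%N -> 0 < s ->
  s <= Num.sqrt (lambda_min (A^T *m A)) ->
  s ^+ 2 * enorm v <= enorm (A^T *m A *m v).
Proof.
move=> n0 s0 sA; have [->|v0] := eqVneq v 0; first by rewrite mulmx0 enorm0 mulr0.
have symA : (A^T *m A)^T = A^T *m A by rewrite trmx_mul trmxK.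
have l0 : 0 < lambda_min (A^T *m A) by rewrite -sqrtr_gt0 (lt_le_trans s0).
rewrite -(ler_pM2l (enorm_gt0 v0)).
apply: le_trans (dot_le_enorm _ _); apply: le_trans (lambda_min_le _ n0 symA).
rewrite mulrCA -expr2 enorm_sqr ler_wpM2r ?dot_ge0 //.
by rewrite -(sqr_sqrtr (ltW l0)) ler_pXn2r ?nnegrE ?sqrtr_ge0 // ltW.
Qed.

End Rayleigh.

(** * Projection onto a compact convex set *)

Section Projection.
Context (R : realType) (n : nat) (X : set 'cV[R]_n).
Implicit Types y z : 'cV[R]_n.
Hypotheses (Xcompact : compact X) (Xconvex : convex_set X) (X0 : X !=set0).

Lemma proj_nearest y :
  X (Defs.proj X y) /\ forall z, X z -> enorm (y - Defs.proj X y) <= enorm (y - z).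
Proof.
apply: (getPex (P := [set p | X p /\ forall z, X z -> enorm (y - p) <= enorm (y - z)])).
have cf : continuous (fun z : 'cV[R]_n => enorm (y - z)).
  move=> z; apply: continuous_comp; last exact: enorm_continuous.
  by apply: continuousB; [exact: cst_continuous|move=> ?; exact: cvg_id].
have [p] := compact_EVT_min X0 Xcompact (continuous_subspaceT cf).
rewrite inE => Xp pmin; exists p; split => // z Xz.
by apply: pmin; rewrite inE.
Qed.

Lemma proj_in y : X (Defs.proj X y).
Proof. by have [] := proj_nearest y. Qed.

(** The points of the segment from [proj X y] to [z] lie in [X], so they are no
    closer to [y] than [proj X y]; near [proj X y] this is the claim. *)
Lemma proj_obtuse y z : X z -> dot (y - Defs.proj X y) (z - Defs.proj X y) <= 0.
Proof.
have [Xp pmin] := proj_nearest y; set p := Defs.proj X y in Xp pmin * => Xz.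
have : 2 * dot (y - p) (z - p) <= 0; last by rewrite pmulr_rle0.
apply: (first_order_le0 (c := dot (z - p) (z - p))) => t /andP[t0 t1].
have : X (t *: z + (1 - t) *: p).
  have := Xconvex (x := z) (y := p) (Itv01 (ltW t0) t1).
  by rewrite !inE => /(_ Xz Xp).
move=> /pmin; rewrite -(ler_pXn2r (n := 2)) ?nnegrE ?enorm_ge0 //.
have -> : y - (t *: z + (1 - t) *: p) = (y - p) - t *: (z - p).
  by apply/colP => i; rewrite !mxE; ring.
rewrite !enorm_sqr; move: (y - p) (z - p) => u w.
rewrite !(dotDl, dotDr, dotNl, dotNr, dotZl, dotZr) (dotC w u).
by move=> h; rewrite -(ler_pM2l t0) -subr_ge0; move: h; lra.
Qed.

(** Add the two obtuse-angle inequalities, each projection being used as the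
    test point for the other, and apply Cauchy-Schwarz. *)
Lemma proj_nonexpansive y y' :
  enorm (Defs.proj X y - Defs.proj X y') <= enorm (y - y').
Proof.
set p := Defs.proj X y; set q := Defs.proj X y'.
have [->|pq] := eqVneq (p - q) 0; first by rewrite enorm0 enorm_ge0.
rewrite -(ler_pM2r (enorm_gt0 pq)); apply: le_trans (dot_le_enorm _ _).
rewrite -expr2 enorm_sqr.
have := proj_obtuse y' (proj_in y); have := proj_obtuse y (proj_in y').
rewrite -/p -/q -(opprB p q) => h1 h2.
have -> : y - y' = (y - p) - (y' - q) + (p - q).
  by apply/colP => i; rewrite !mxE; ring.
move: h1 h2; move: (y - p) (y' - q) (p - q) => u v w.
rewrite !(dotDl, dotNl, dotNr); lra.
Qed.

End Projection.

(** * Splitting a map among the agents *)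

Section Blocks.
Context (R : realType) (nag N : nat) (Ms : 'I_nag -> nat).
Implicit Types (g : 'cV[R]_N -> 'cV[R]_(\sum_i Ms i)).

(** Chain rule: taking a block of a row vector is linear and continuous, hence
    its own differential. *)
Lemma jac_agent_map g i x : differentiable g x ->
  jac (@agent_map R nag N Ms g i) x = submxcol (jac g x) i.
Proof.
move=> dg; have ct m k : continuous (@trmx R m k).
  by apply: (reindex_mx_continuous (s := fun i j => j) (t := fun i j => i)) => M a b;
     rewrite mxE.
have dt m k (A : 'M[R]_(m, k)) : differentiable (@trmx R m k) A.
  by apply: (linear_differentiable (f := @trmx R m k)); exact: ct.
pose F (u : 'rV[R]_N) := (g u^T)^T.
pose h (r : 'rV[R]_(\sum_i Ms i)) := (submxcol r^T i)^T.
have hlin : linear h.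
  by move=> a u v; apply/rowP => j; rewrite !mxE.
pose hL := GRing.isLinear.Build _ _ _ _ h hlin.
pose H : {linear 'rV[R]_(\sum_i Ms i) -> 'rV[R]_(Ms i)} := HB.pack h hL.
have cH : continuous H.
  apply: (reindex_mx_continuous (s := fun a _ => a)
    (t := fun _ j => tagnat.Rank i j)) => M a b.
  by rewrite /= !mxE.
have dF : differentiable F x^T.
  apply: differentiable_comp; last exact: dt.
  by apply: differentiable_comp; [exact: dt|rewrite trmxK].
have dHF := diff_comp dF (linear_differentiable (F x^T) cH).
rewrite /jac /jacobian.
have -> : (fun u : 'rV[R]_N => (agent_map g i u^T)^T) = H \o F.
  by apply/funext => u; rewrite /= /h trmxK.
rewrite dHF (diff_lin _ cH).
by apply/matrixP => a b; rewrite !mxE.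
Qed.

Lemma dot_submxcol (u v : 'cV[R]_(\sum_i Ms i)) :
  dot u v = \sum_i dot (submxcol u i) (submxcol v i).
Proof.
rewrite /dot -[in LHS](submxcolK u) -[in LHS](submxcolK v) tr_mxcol.
by rewrite mul_mxrow_mxcol summxE.
Qed.

Lemma enorm_submxcol (u : 'cV[R]_(\sum_i Ms i)) i :
  enorm (submxcol u i) <= enorm u.
Proof.
rewrite -(ler_pXn2r (n := 2)) ?nnegrE ?enorm_ge0 // !enorm_sqr.
rewrite dot_submxcol (bigD1 i) //= lerDl.
by apply: sumr_ge0 => j _; exact: dot_ge0.
Qed.

Lemma sum_agent_gram g x : differentiable g x ->
  \sum_i agent_gram g i x = (jac g x)^T *m jac g x.
Proof.
move=> dg; rewrite -(submxcolK (jac g x)) tr_mxcol mul_mxrow_mxcol.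
by apply: eq_bigr => i _; rewrite /agent_gram jac_agent_map // submxcolK.
Qed.

Lemma sum_agent_grad g x : differentiable g x ->
  \sum_i agent_grad g i x = (jac g x)^T *m g x.
Proof.
move=> dg; rewrite -(submxcolK (jac g x)) -[g x in RHS]submxcolK.
rewrite tr_mxcol mul_mxrow_mxcol.
by apply: eq_bigr => i _; rewrite /agent_grad jac_agent_map // submxcolK.
Qed.

Section OperatorBound.
Context (g : 'cV[R]_N -> 'cV[R]_(\sum_i Ms i)) (x : 'cV[R]_N) (s e : R).
Hypotheses (dg : differentiable g x) (s0 : 0 <= s).
Hypotheses (Gs : forall v, enorm (jac g x *m v) <= s * enorm v).
Hypothesis (ge : enorm (g x) <= e).

Lemma enorm_jac_agent_map i v :
  enorm (jac (agent_map g i) x *m v) <= s * enorm v.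
Proof.
by rewrite jac_agent_map // submxcol_mul (le_trans (enorm_submxcol _ _)).
Qed.

Lemma enorm_agent_gram i v :
  enorm (agent_gram g i x *m v) <= s ^+ 2 * enorm v.
Proof.
rewrite /agent_gram -mulmxA.
apply: le_trans (enorm_trmx_le s0 (@enorm_jac_agent_map i) _) _.
by rewrite expr2 -mulrA ler_wpM2l // enorm_jac_agent_map.
Qed.

Lemma enorm_agent_grad i : enorm (agent_grad g i x) <= s * e.
Proof.
apply: le_trans (enorm_trmx_le s0 (@enorm_jac_agent_map i) _) _.
by rewrite ler_wpM2l // (le_trans (enorm_submxcol _ _)).
Qed.

End OperatorBound.
End Blocks.

(** * Gossip averaging *)

Fixpoint transition (R : realType) (nag : nat) (W : nat -> 'M[R]_nag)
    (s t : nat) : 'M[R]_nag :=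
  if t is t'.+1 then W (s + t)%N *m transition W s t' else 1%:M.

Section Stochastic.
Context (R : realType) (nag : nat).
Implicit Types A B : 'M[R]_nag.

Lemma doubly_stochastic1 : doubly_stochastic (1%:M : 'M[R]_nag).
Proof.
split=> [i j|i|j]; first by rewrite mxE ler0n.
  rewrite (bigD1 i) //= big1 ?addr0 ?mxE ?eqxx // => j ji.
  by rewrite mxE eq_sym (negbTE ji).
rewrite (bigD1 j) //= big1 ?addr0 ?mxE ?eqxx // => i ij.
by rewrite mxE (negbTE ij).
Qed.

Lemma doubly_stochastic_mul A B :
  doubly_stochastic A -> doubly_stochastic B -> doubly_stochastic (A *m B).
Proof.
move=> [A0 Ar Ac] [B0 Br Bc]; split=> [i j|i|j].
- by rewrite mxE; apply: sumr_ge0 => k _; rewrite mulr_ge0.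
- under eq_bigr do rewrite mxE.
  rewrite exchange_big /= -(Ar i); apply: eq_bigr => k _.
  by rewrite -mulr_sumr Br mulr1.
- under eq_bigr do rewrite mxE.
  rewrite exchange_big /= -(Bc j); apply: eq_bigr => k _.
  by rewrite -mulr_suml Ac mul1r.
Qed.

Lemma doubly_stochastic_le1 A i j : doubly_stochastic A -> A i j <= 1.
Proof.
by move=> [A0 Ar _]; rewrite -(Ar i) (bigD1 j) //= lerDl; exact: sumr_ge0.
Qed.

Lemma mulmx_entry_ge A B i k j :
  doubly_stochastic A -> doubly_stochastic B -> A i k * B k j <= (A *m B) i j.
Proof.
move=> [A0 _ _] [B0 _ _]; rewrite mxE (bigD1 k) //= lerDl.
by apply: sumr_ge0 => l _; rewrite mulr_ge0.
Qed.

(** Every average computed by [A] gives weight at least [c] to the same value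
    [u j0], so both ends of the range of [u] move towards [u j0] by the factor
    [c]. *)
Lemma average_spread A (u : 'I_nag -> R) (c m s : R) (j0 : 'I_nag) :
  doubly_stochastic A -> (forall i j, c <= A i j) ->
  (forall i, m <= u i <= m + s) ->
  exists m', forall i, m' <= \sum_j A i j * u j <= m' + (1 - c) * s.
Proof.
move=> [A0 Ar _] cA um; exists (m + c * (u j0 - m)) => i.
have shift a : \sum_j A i j * u j - a = \sum_j A i j * (u j - a).
  under [RHS]eq_bigr do rewrite mulrBr.
  by rewrite sumrB -mulr_suml Ar mul1r.
have lo : c * (u j0 - m) <= \sum_j A i j * u j - m.
  rewrite shift (bigD1 j0) //= -[leLHS]addr0; apply: lerD.
    by rewrite ler_wpM2r // subr_ge0; case/andP: (um j0).
  by apply: sumr_ge0 => j _; rewrite mulr_ge0 // subr_ge0; case/andP: (um j).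
have hi : c * (m + s - u j0) <= - (\sum_j A i j * u j - (m + s)).
  rewrite shift -sumrN (bigD1 j0) //= -[leLHS]addr0; apply: lerD.
    by rewrite -mulrN opprB ler_wpM2r // subr_ge0; case/andP: (um j0).
  apply: sumr_ge0 => j _; rewrite -mulrN opprB mulr_ge0 // subr_ge0.
  by case/andP: (um j).
apply/andP; split; first by lra.
by move: hi; rewrite !mulrBr mulrBl mulrDr mul1r; lra.
Qed.

End Stochastic.

Section Transition.
Context (R : realType) (nag : nat) (W : nat -> 'M[R]_nag).
Implicit Types (s t u : nat) (i j : 'I_nag).

Lemma transitionD s t u :
  transition W s (t + u) = transition W (s + t) u *m transition W s t.
Proof.
elim: u => [|u IH]; first by rewrite addn0 mul1mx.
by rewrite addnS /= IH mulmxA addnS addnA addnS.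
Qed.

Lemma gossip_transition (V : lmodType R) (v : 'I_nag -> V) l i :
  gossip W v l i = \sum_j transition W 0 l i j *: v j.
Proof.
elim: l i => [|l IH] i.
  rewrite (bigD1 i) //= big1 ?addr0 ?mxE ?eqxx ?scale1r // => j ji.
  by rewrite mxE eq_sym (negbTE ji) scale0r.
rewrite [LHS]/=; under eq_bigr do rewrite IH scaler_sumr.
rewrite exchange_big /=; apply: eq_bigr => j _.
by rewrite mxE add0n scaler_suml; apply: eq_bigr => k _; rewrite scalerA.
Qed.

(** Gossiping matrices and then applying the result to a vector is gossiping
    vectors, so a deviation bound for vectors is enough. *)
Lemma gossip_mulmx n p q (H : 'I_nag -> 'M[R]_(n, p)) (v : 'M[R]_(p, q)) l i :
  gossip W H l i *m v = gossip W (fun j => H j *m v) l i.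
Proof.
elim: l i => [//|l IH] i /=; rewrite mulmx_suml.
by apply: eq_bigr => j _; rewrite -scalemxAl IH.
Qed.

Hypothesis (Wds : forall l, (0 < l)%N -> doubly_stochastic (W l)).

Lemma doubly_stochastic_transition s t : doubly_stochastic (transition W s t).
Proof.
elim: t => [|t IH] /=; first exact: doubly_stochastic1.
by apply: doubly_stochastic_mul => //; apply: Wds; rewrite addnS.
Qed.

Context (eta : R).
Hypotheses (eta_gt0 : 0 < eta) (Wdiag : forall l i, (0 < l)%N -> eta <= W l i i).

Lemma transition_hold c s t u i j : 0 <= c ->
  c <= transition W s t i j -> c * eta ^+ u <= transition W s (t + u) i j.
Proof.
move=> c0 ct; elim: u => [|u IH]; first by rewrite expr0 mulr1 addn0.
rewrite addnS /=; apply: le_trans (mulmx_entry_ge i i j _ _); last 2 first.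
- by apply: Wds; rewrite addnS.
- exact: doubly_stochastic_transition.
have e0 := ltW eta_gt0.
rewrite exprS mulrCA ler_pM // ?mulr_ge0 ?exprn_ge0 //.
by apply: Wdiag; rewrite addnS.
Qed.

Context (e : rel 'I_nag) (L : nat).
Hypothesis (window : forall l i j, (0 < l)%N -> e i j ->
  exists2 l', (l' < L)%N & eta <= W (l + l') j i).

(** The weight [eta ^+ _] travels along the path, one edge per window of [L]
    exchanges: in each window it waits at the current vertex, which costs
    [eta] per exchange by the diagonal weights, crosses the next edge when that
    edge is active, and waits again. *)
Lemma transition_path s j p : path e j p ->
  eta ^+ (size p * L) <= transition W s (size p * L) (last j p) j.
Proof.
elim/last_ind: p => [_|p i IH]; first by rewrite /= mul0n expr0 mxE eqxx.
rewrite rcons_path last_rcons size_rcons => /andP[/IH{}IH ei].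
set T := (size p * L)%N in IH *; set k := last j p in IH ei.
have [l' l'L Wl'] := window (ltn0Sn (s + T)) ei.
have e0 u : 0 <= eta ^+ u by rewrite exprn_ge0 // ltW.
have h1 := transition_hold l' (e0 _) IH.
have h2 : eta ^+ T * eta ^+ l'.+1 <= transition W s (T + l').+1 i j.
  apply: le_trans (mulmx_entry_ge i k j _ _); last 2 first.
  - by apply: Wds; rewrite addnS.
  - exact: doubly_stochastic_transition.
  rewrite exprS mulrCA ler_pM ?mulr_ge0 // ?(ltW eta_gt0) //.
  by rewrite addnS addnA -addSn.
have h3 := transition_hold (L - l'.+1) (mulr_ge0 (e0 _) (e0 _)) h2.
have TL : ((T + l').+1 + (L - l'.+1) = (size p).+1 * L)%N.
  by rewrite mulSn -addnS -addnA subnKC // addnC.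
by move: h3; rewrite -!exprD TL; congr (_ <= _); congr (eta ^+ _); rewrite -TL addnS.
Qed.

Hypothesis (nag_gt0 : (0 < nag)%N).
Hypothesis (econn : forall i j, connect e i j).

Let L0 := ((nag - 1) * L)%N.
Let c := eta ^+ L0.

(** Connectedness supplies a path with at most [nag - 1] edges between any two
    agents; each edge is crossed within [L] exchanges. *)
Lemma transition_positive s i j : c <= transition W s L0 i j.
Proof.
have /connectP[p0 pp0 ->] := econn j i.
case/shortenP: pp0 => p pp /card_uniqP up _.
have szp : (size p <= nag - 1)%N.
  have := max_card (mem (j :: p)); rewrite card_ord up /= => szp.
  by rewrite -ltnS subn1 prednK.
have := transition_hold (L0 - size p * L) _ (transition_path s pp).
by rewrite -exprD subnKC ?leq_mul2r ?szp ?orbT //; apply; rewrite exprn_ge0 // ltW.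
Qed.

Lemma transition_spread r q j :
  exists m, forall i, m <= transition W 0 (r + q * L0) i j <= m + (1 - c) ^+ q.
Proof.
elim: q => [|q [m mq]].
  exists 0 => i; rewrite add0r expr0 mul0n addn0.
  have ds := doubly_stochastic_transition 0 r.
  by rewrite doubly_stochastic_le1 // andbT; case: ds.
have [m' m'q] := average_spread (u := fun i => transition W 0 (r + q * L0) i j)
   (Ordinal nag_gt0) (doubly_stochastic_transition (r + q * L0) L0)
   (transition_positive _) mq.
exists m' => i; rewrite exprS mulSn [(L0 + _)%N]addnC addnA transitionD add0n mxE.
exact: m'q.
Qed.

(** The columns of a transition matrix sum to 1, so [nag%:R^-1] is the mean of
    the entries of a column and lies within their range. *)
Lemma transition_deviation r q i j :
  `|transition W 0 (r + q * L0) i j - nag%:R^-1| <= (1 - c) ^+ q.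
Proof.
have [m mq] := transition_spread r q j.
have [_ _ cs] := doubly_stochastic_transition 0 (r + q * L0).
have n0 : 0 < nag%:R :> R by rewrite ltr0n.
have lo : m <= nag%:R^-1.
  rewrite -[leRHS]div1r ler_pdivlMr // -[leRHS](cs j) mulr_natr -[nag in leLHS]card_ord.
  by rewrite -sumr_const; apply: ler_sum => k _; case/andP: (mq k).
have hi : nag%:R^-1 <= m + (1 - c) ^+ q.
  rewrite -[leLHS]div1r ler_pdivrMr // -[leLHS](cs j) mulr_natr -[nag in leRHS]card_ord.
  by rewrite -sumr_const; apply: ler_sum => k _; case/andP: (mq k).
by have /andP[] := mq i; rewrite ler_norml; lra.
Qed.

Context (lam : R).
Hypotheses (lam01 : 0 < lam <= 1) (lamL0 : lam ^+ L0 = 1 - c) (L0_gt0 : (0 < L0)%N).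

(** The spread decreases only every [L0] exchanges; replacing [l %/ L0] by
    [(l + 1) / L0 - 1] in the exponent costs the factor [(1 - c)^-1]. *)
Lemma transition_deviation_geometric l i j :
  `|transition W 0 l i j - nag%:R^-1| <= lam ^+ l.+1 / (1 - c).
Proof.
have /andP[l0 l1] := lam01.
rewrite {1}(divn_eq l L0) addnC; apply: le_trans (transition_deviation _ _ _ _) _.
rewrite -lamL0 ler_pdivlMr ?exprn_gt0 // -exprSr -exprM.
apply: ler_wiXn2l => //; first exact: ltW.
by rewrite mulnC mulSn addnC {1}(divn_eq l L0) -addnS leq_add2l ltn_mod.
Qed.

Lemma gossip_deviation n (v : 'I_nag -> 'cV[R]_n) b l i :
  (forall j, enorm (v j) <= b) ->
  enorm (gossip W v l i - nag%:R^-1 *: \sum_j v j)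
    <= nag%:R * (lam ^+ l.+1 / (1 - c)) * b.
Proof.
move=> vb; rewrite gossip_transition scaler_sumr -sumrB.
apply: le_trans (enorm_sum _) _.
apply: (le_trans (y := \sum_(j < nag) (lam ^+ l.+1 / (1 - c) * b))); last first.
  by rewrite sumr_const card_ord -[leLHS]mulr_natl -[leRHS]mulrA.
apply: ler_sum => j _; rewrite -scalerBl enormZ ler_pM ?enorm_ge0 //.
exact: transition_deviation_geometric.
Qed.

End Transition.

(** Update by update, the recurrent edges play the part of [e]. *)
Lemma network_gossip_deviation (R : realType) (nag N : nat)
    (E : nat -> nat -> rel 'I_nag) (L : nat) (W : nat -> nat -> 'M[R]_nag)
    (eta lam b : R) (k l : nat) (v : 'I_nag -> 'cV[R]_N) (i : 'I_nag) :
  network_connectivity E L -> weight_assumption E eta W -> (0 < nag)%N ->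
  0 < lam <= 1 -> lam ^+ ((nag - 1) * L) = 1 - eta ^+ ((nag - 1) * L) ->
  (0 < (nag - 1) * L)%N -> (forall j, enorm (v j) <= b) ->
  enorm (gossip (W k) v l i - nag%:R^-1 *: \sum_j v j)
    <= nag%:R * (lam ^+ l.+1 / (1 - eta ^+ ((nag - 1) * L))) * b.
Proof.
move=> [hEgraph econn _ hEwin] [/andP[eta_gt0 _] hWds hWdiag hWedge].
move=> nag_gt0 lam01 lamL0 L0_gt0.
have ds l1 : (0 < l1)%N -> doubly_stochastic (W k l1) by case/(hWds k l1).
have win l1 i' j : (0 < l1)%N -> recurrent_edge E k i' j ->
    exists2 l', (l' < L)%N & eta <= W k (l1 + l')%N j i'.
  move=> l0 eij; have [l' l'L El] := hEwin k l1 i' j l0 eij.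
  exists l' => //; have ll' : (0 < l1 + l')%N by rewrite addn_gt0 l0.
  have [_ irr] := hEgraph k (l1 + l')%N ll'.
  have [<- _] := hWds k _ ll'; rewrite mxE.
  have ij : i' != j by apply: contraTneq El => ->; rewrite irr.
  by have [h _] := hWedge k _ i' j ll' ij; exact: h.
exact: (gossip_deviation ds eta_gt0 (hWdiag k) win nag_gt0 (econn k) lam01
  lamL0 L0_gt0).
Qed.

(** * Perturbation of the descent directions *)

Section Perturbation.
Context (R : realType) (n : nat).
Implicit Types (M H : 'M[R]_n) (v b x : 'cV[R]_n).

Lemma solution_diff M M' x x' b b' a :
  M *m x = b -> M' *m x' = b' -> (forall v, enorm v <= a * enorm (M *m v)) ->
  0 <= a -> enorm (x - x') <= a * (enorm (b - b') + enorm (M *m x' - M' *m x')).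
Proof.
move=> Mx M'x' aM a0; apply: le_trans (aM _) _; rewrite ler_wpM2l //.
have -> : M *m (x - x') = (b - b') - (M *m x' - M' *m x').
  by rewrite mulmxBr Mx M'x' opprB addrA subrK.
exact: enormB.
Qed.

(** Under [a * e <= 2^-1] the perturbation accounts for at most half of
    [enorm v], which doubles the constant. *)
Lemma perturbed_lower_bound M H a e :
  (forall v, enorm v <= a * enorm (H *m v)) -> 0 <= a ->
  (forall v, enorm (M *m v - H *m v) <= e * enorm v) -> a * e <= 2^-1 ->
  forall v, enorm v <= 2 * a * enorm (M *m v).
Proof.
move=> aH a0 eMH ae v.
have h1 : a * enorm (H *m v) <= a * (enorm (M *m v) + e * enorm v).
  rewrite ler_wpM2l //; have -> : H *m v = M *m v - (M *m v - H *m v).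
    by rewrite opprB addrC subrK.
  by apply: le_trans (enormB _ _) _; rewrite lerD2l.
have h2 : a * e * enorm v <= 2^-1 * enorm v by rewrite ler_wpM2r ?enorm_ge0.
by have := aH v; move: h1 h2; rewrite mulrDr mulrA; lra.
Qed.

(** [Ht i] and [ht i] are the system that agent [i] solves, [He i] and [he i]
    the one it should solve; [Hb] and [hb] are the average towards which all
    the systems [Ht i] and [ht i] are driven by the gossip. *)
Context (I : Type) (Ht He : I -> 'M[R]_n) (ht he dt de : I -> 'cV[R]_n).
Context (Hb : 'M[R]_n) (hb : 'cV[R]_n) (a c p q : R).
Hypotheses (dtP : forall i, Ht i *m dt i = ht i).
Hypotheses (deP : forall i, He i *m de i = he i).
Hypotheses (a_ge0 : 0 <= a) (aP : forall i v, enorm v <= a * enorm (He i *m v)).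
Hypotheses (cP : forall i, 2 * (1 + enorm (de i)) <= c).
Hypotheses (p_ge0 : 0 <= p) (q_ge0 : 0 <= q) (pq : a * (p + q) <= 8^-1).
Hypotheses (htP : forall i, enorm (ht i - hb) <= p).
Hypotheses (HtP : forall i v, enorm (Ht i *m v - Hb *m v) <= p * enorm v).
Hypotheses (heP : forall i, enorm (hb - he i) <= q).
Hypotheses (HeP : forall i v, enorm (Hb *m v - He i *m v) <= q * enorm v).

Let HtHe i v : enorm (Ht i *m v - He i *m v) <= (p + q) * enorm v.
Proof.
rewrite -(subrK (Hb *m v) (Ht i *m v)) -addrA mulrDl.
by apply: le_trans (enormD _ _) _; exact: lerD.
Qed.

Let hthe i : enorm (ht i - he i) <= p + q.
Proof.
rewrite -(subrK hb (ht i)) -addrA.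
by apply: le_trans (enormD _ _) _; exact: lerD.
Qed.

Let Ht_lower i v : enorm v <= 2 * a * enorm (Ht i *m v).
Proof.
apply: (perturbed_lower_bound (aP i) a_ge0 (HtHe i)).
apply: le_trans pq _; lra.
Qed.

Lemma descent_error i : enorm (dt i - de i) <= c * a * (p + q).
Proof.
have a2 : 0 <= 2 * a by rewrite mulr_ge0.
apply: le_trans (solution_diff (dtP i) (deP i) (@Ht_lower i) a2) _.
apply: (le_trans (y := 2 * a * ((p + q) * (1 + enorm (de i))))).
  by rewrite ler_wpM2l // mulrDr mulr1 lerD.
have -> : 2 * a * ((p + q) * (1 + enorm (de i)))
        = a * (p + q) * (2 * (1 + enorm (de i))) by ring.
have -> : c * a * (p + q) = a * (p + q) * c by ring.
by rewrite ler_wpM2l // mulr_ge0 // addr_ge0.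
Qed.

(** Two agents solve nearly the same linear system, whatever the distance [q]
    from the averaged system to their own exact systems: this is why [q] does
    not appear on the right, and why disagreement between the iterates does not
    feed on itself. *)
Lemma descent_disagreement i j : enorm (dt i - dt j) <= 3 * c * a * p.
Proof.
have a2 : 0 <= 2 * a by rewrite mulr_ge0.
have c0 : 0 <= c.
  by apply: le_trans (cP i); rewrite mulr_ge0 // addr_ge0 ?enorm_ge0.
have dj : 1 + enorm (dt j) <= 3 / 4 * c.
  have h1 : enorm (dt j) <= enorm (dt j - de j) + enorm (de j).
    by rewrite -{1}(subrK (de j) (dt j)) enormD.
  have h2 := descent_error j.
  have h3 : c * (a * (p + q)) <= c * 8^-1 by rewrite ler_wpM2l.
  by have := cP j; move: h1 h2 h3; rewrite -mulrA; lra.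
apply: le_trans (solution_diff (dtP i) (dtP j) (@Ht_lower i) a2) _.
have e1 : enorm (ht i - ht j) <= 2 * p.
  rewrite -(subrK hb (ht i)) -addrA; apply: le_trans (enormD _ _) _.
  by rewrite (enormBC hb) mulr_natl mulr2n lerD.
have e2 : enorm (Ht i *m dt j - Ht j *m dt j) <= 2 * p * enorm (dt j).
  rewrite -(subrK (Hb *m dt j) (Ht i *m dt j)) -addrA.
  apply: le_trans (enormD _ _) _.
  by rewrite (enormBC (Hb *m dt j)) -mulrA mulr_natl mulr2n lerD.
apply: (le_trans (y := 2 * a * (2 * p * (1 + enorm (dt j))))).
  by rewrite ler_wpM2l // mulrDr mulr1 lerD.
have -> : 2 * a * (2 * p * (1 + enorm (dt j)))
        = 4 * (a * p) * (1 + enorm (dt j)) by ring.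
have -> : 3 * c * a * p = 4 * (a * p) * (3 / 4 * c) by field.
by rewrite ler_wpM2l // !mulr_ge0.
Qed.

End Perturbation.

(** * One update of the algorithm *)

Lemma enorm_mean_diff (R : realType) (nag n : nat) (u w : 'I_nag -> 'cV[R]_n) q :
  (0 < nag)%N -> (forall j, enorm (u j - w j) <= q) ->
  enorm (nag%:R^-1 *: \sum_j u j - nag%:R^-1 *: \sum_j w j) <= q.
Proof.
move=> nag_gt0 uw; rewrite -scalerBr -sumrB enormZ normfV normr_nat.
rewrite mulrC ler_pdivrMr ?ltr0n //; apply: le_trans (enorm_sum _) _.
rewrite mulr_natr -[nag in leRHS]card_ord -sumr_const.
by apply: ler_sum => j _.
Qed.

Lemma mean_mulmx (R : realType) (nag m n p : nat) (f : 'I_nag -> 'M[R]_(m, n))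
    (v : 'M[R]_(n, p)) :
  nag%:R^-1 *: (\sum_j f j) *m v = nag%:R^-1 *: \sum_j (f j *m v).
Proof. by rewrite -scalemxAl mulmx_suml. Qed.

Section OneUpdate.
Context (R : realType) (nag N : nat) (Ms : 'I_nag -> nat).
Context (g : 'cV[R]_N -> 'cV[R]_(\sum_i Ms i)) (X : set 'cV[R]_N).
Context (eps_max sigma_min sigma_max nu : R).
Hypotheses (nag_gt0 : (0 < nag)%N) (dg : forall y, differentiable g y).
Hypotheses (geps : forall y, X y -> enorm (g y) <= eps_max).
Hypotheses (smin_gt0 : 0 < sigma_min) (smax_ge0 : 0 <= sigma_max).
Hypotheses (nu_ge0 : 0 <= nu).
Hypothesis (Gmax : forall y v, X y -> enorm (jac g y *m v) <= sigma_max * enorm v).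
Hypothesis (Gmin : forall y v, X y ->
  sigma_min ^+ 2 * enorm v <= enorm ((jac g y)^T *m jac g y *m v)).
Hypothesis (grad_lip : forall i y y', X y -> X y' ->
  enorm (agent_grad g i y - agent_grad g i y') <= nu * enorm (y - y')).
Hypothesis (gram_lip : forall i y y' v, X y -> X y' ->
  enorm (agent_gram g i y *m v - agent_gram g i y' *m v)
    <= nu * enorm (y - y') * enorm v).

Local Notation C1 := (2 * (1 + sigma_max * eps_max / sigma_min ^+ 2)).
Local Notation C2 := (nag%:R / sigma_min ^+ 2).

Lemma gram_unitmx y : X y -> (jac g y)^T *m jac g y \in unitmx.
Proof.
move=> Xy; rewrite -unitmx_tr -row_free_unit -kermx_eq0; apply/rowV0P => w.
move=> /sub_kermxP wG; apply: trmx_inj; rewrite trmx0; apply: enorm0_eq0.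
apply/eqP; rewrite eq_le enorm_ge0 andbT -(pmulr_rle0 _ (exprn_gt0 2 smin_gt0)).
apply: le_trans (Gmin _ Xy) _.
by rewrite -[_ *m jac g y]trmxK -trmx_mul wG trmx0 enorm0.
Qed.

Lemma exact_descentP y : X y ->
  (jac g y)^T *m jac g y *m exact_descent g y = (jac g y)^T *m g y.
Proof. by move=> Xy; rewrite mulmxA mulmxV ?mul1mx // gram_unitmx. Qed.

Lemma enorm_exact_descent y : X y ->
  enorm (exact_descent g y) <= sigma_max * eps_max / sigma_min ^+ 2.
Proof.
move=> Xy; rewrite ler_pdivlMr ?exprn_gt0 // mulrC.
apply: le_trans (Gmin _ Xy) _; rewrite exact_descentP //.
apply: le_trans (enorm_trmx_le smax_ge0 (fun v => Gmax v Xy) _) _.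
by rewrite ler_wpM2l // geps.
Qed.

Context (W : nat -> 'M[R]_nag) (l : nat) (x : 'I_nag -> 'cV[R]_N) (p r rho : R).
Hypothesis (Xx : forall i, X (x i)).
Hypothesis (xr : forall i j, enorm (x i - x j) <= r).
Hypothesis (dev : forall (v : 'I_nag -> 'cV[R]_N) b i,
  (forall j, enorm (v j) <= b) ->
  enorm (gossip W v l i - nag%:R^-1 *: \sum_j v j) <= rho * b).
Hypotheses (rho_grad : rho * (sigma_max * eps_max) <= p).
Hypotheses (rho_gram : rho * sigma_max ^+ 2 <= p).
Hypotheses (p_ge0 : 0 <= p) (r_ge0 : 0 <= r).
Hypotheses (small : C2 * (p + nu * r) <= 8^-1).
Hypothesis (inv : forall i, gossip_H g W x l i \in unitmx).

Let Hb := nag%:R^-1 *: \sum_j agent_gram g j (x j).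
Let hb := nag%:R^-1 *: \sum_j agent_grad g j (x j).
Let He i := nag%:R^-1 *: ((jac g (x i))^T *m jac g (x i)).
Let he i := nag%:R^-1 *: ((jac g (x i))^T *m g (x i)).

Let HtP i v : enorm (gossip_H g W x l i *m v - Hb *m v) <= p * enorm v.
Proof.
rewrite /gossip_H gossip_mulmx /Hb mean_mulmx.
apply: (le_trans (y := rho * (sigma_max ^+ 2 * enorm v))); last first.
  by rewrite mulrA ler_wpM2r ?enorm_ge0.
apply: dev => j.
exact: (enorm_agent_gram (dg (x j)) smax_ge0 (fun w => Gmax w (Xx j))).
Qed.

Let htP i : enorm (gossip_h g W x l i - hb) <= p.
Proof.
apply: le_trans rho_grad; apply: dev => j.
exact: (enorm_agent_grad (dg (x j)) smax_ge0 (fun w => Gmax w (Xx j)) (geps (Xx j))).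
Qed.

Let HeP i v : enorm (Hb *m v - He i *m v) <= nu * r * enorm v.
Proof.
rewrite /Hb /He -(sum_agent_gram (dg (x i))).
rewrite [X in enorm (X - _)]mean_mulmx [X in enorm (_ - X)]mean_mulmx.
apply: enorm_mean_diff => // j; apply: le_trans (gram_lip _ _ (Xx j) (Xx i)) _.
by rewrite ler_wpM2r ?enorm_ge0 // ler_wpM2l.
Qed.

Let heP i : enorm (hb - he i) <= nu * r.
Proof.
rewrite /hb /he -(sum_agent_grad (dg (x i))).
apply: enorm_mean_diff => // j; apply: le_trans (grad_lip _ (Xx j) (Xx i)) _.
by rewrite ler_wpM2l.
Qed.

Let n0 : 0 < nag%:R :> R. Proof. by rewrite ltr0n. Qed.

Let He_lower i v : enorm v <= C2 * enorm (He i *m v).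
Proof.
rewrite /He -scalemxAl enormZ normfV normr_nat mulrA.
rewrite [nag%:R / _]mulrC mulfK ?gt_eqF //.
by rewrite ler_pdivlMl ?exprn_gt0 // Gmin.
Qed.

Let C2_ge0 : 0 <= C2. Proof. by rewrite divr_ge0 ?exprn_ge0 ?ltW. Qed.

Let dtP i : gossip_H g W x l i *m inexact_descent g W x l i = gossip_h g W x l i.
Proof. by rewrite mulmxA mulmxV ?mul1mx // inv. Qed.

Let deP i : He i *m exact_descent g (x i) = he i.
Proof. by rewrite -scalemxAl exact_descentP. Qed.

Let C1P i : 2 * (1 + enorm (exact_descent g (x i))) <= C1.
Proof. by rewrite ler_wpM2l // lerD2l enorm_exact_descent. Qed.

Let nur_ge0 : 0 <= nu * r. Proof. exact: mulr_ge0. Qed.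

Lemma inexact_descent_error i :
  enorm (inexact_descent g W x l i - exact_descent g (x i))
    <= C1 * C2 * (p + nu * r).
Proof.
exact: (descent_error (I := 'I_nag) dtP deP C2_ge0 He_lower C1P p_ge0 nur_ge0
  small htP HtP heP HeP).
Qed.

Lemma inexact_descent_disagreement i j :
  enorm (inexact_descent g W x l i - inexact_descent g W x l j)
    <= 3 * C1 * C2 * p.
Proof.
exact: (descent_disagreement (I := 'I_nag) dtP deP C2_ge0 He_lower C1P p_ge0
  nur_ge0 small htP HtP heP HeP).
Qed.

End OneUpdate.

(** * The constants of the algorithm *)

Lemma root_powR (R : realType) (a : R) n : 0 <= a -> (0 < n)%N ->
  (a `^ n%:R^-1) ^+ n = a.
Proof.
move=> a0 n0; rewrite -powR_mulrn ?powR_ge0 // -powRrM mulVf ?powRr1 //.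
by rewrite pnatr_eq0 -lt0n.
Qed.

(** [ln lam] is negative, so clearing the denominator reverses the inequality
    between [l] and the quotient of logarithms. *)
Lemma expr_le_of_ceil (R : realType) (lam y : R) (l : nat) :
  0 < lam < 1 -> 0 < y -> l%:Z = Num.ceil (ln y / ln lam) -> lam ^+ l <= y.
Proof.
move=> lam01 y0 lE; have /andP[l0 l1] := lam01.
have lnl : ln lam < 0 by rewrite ln_lt0.
have : ln y / ln lam <= l%:R by rewrite -[l%:R]/(l%:Z%:~R) lE ceil_ge.
rewrite ler_ndivrMr // mulr_natl => h.
by rewrite -ler_ln ?posrE ?exprn_gt0 // lnXn.
Qed.

Lemma partial_sum_le_lim (R : realType) (u : nat -> R) (s : R) :
  (forall k, 0 <= u k) -> (\sum_(0 <= k < K.+1) u k) @[K --> \oo] --> s ->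
  forall K, \sum_(0 <= k < K) u k <= s.
Proof.
move=> u0 us K.
have inc : nondecreasing_seq (fun K => \sum_(0 <= k < K.+1) u k).
  apply/nondecreasing_seqP => k.
  by rewrite [leRHS]big_nat_recr //= lerDl.
rewrite -(cvg_lim _ us) //; apply: le_trans (nondecreasing_cvgn_le inc _ K).
  by rewrite big_nat_recr //= lerDl.
by apply: cvgP us.
Qed.

Lemma kappa_cvg0 (R : realType) (C1 D lam : R) : 0 < lam < 1 ->
  kappa C1 D lam l @[l --> \oo] --> (0 : R).
Proof.
move=> /andP[l0 l1]; rewrite /kappa.
rewrite -[X in _ --> X](mulr0 (4 * C1 * D)); apply: cvgM; first exact: cvg_cst.
rewrite -[X in _ --> X](mulr0 lam).
under eq_fun do rewrite exprS.
apply: cvgM; first exact: cvg_cst.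
by apply: cvg_expr; rewrite gtr0_norm.
Qed.

Theorem theorem2 (R : realType) (nag N : nat) (Ms : 'I_nag -> nat)
    (hnag : (2 <= nag)%N) (hN : (0 < N)%N)
    (X : set 'cV[R]_N) (hXcompact : compact X) (hXconvex : convex_set X)
    (g : 'cV[R]_N -> 'cV[R]_(\sum_(i < nag) Ms i))
    (hgdiff : forall x, differentiable g x) (hgC1 : continuous (jac g))
    (* data assumptions *)
    (eps_max sigma_min sigma_max omega : R)
    (heps : forall x, X x -> enorm (g x) <= eps_max)
    (hrank : forall x, X x -> \rank (jac g x) = N)
    (hsmin : is_min X
       (fun x => Num.sqrt (lambda_min ((jac g x)^T *m jac g x))) sigma_min)
    (hsmax : is_max X
       (fun x => Num.sqrt (lambda_max ((jac g x)^T *m jac g x))) sigma_max)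
    (hsigma : 0 < sigma_min <= sigma_max)
    (homega : 0 < omega)
    (hlip : forall x x', X x -> X x' ->
       specnorm (jac g x - jac g x') <= omega * enorm (x - x'))
    (* Lipschitz constants *)
    (nu_delta nu_Delta nu : R)
    (hnu_delta : omega * (eps_max + sigma_max) <= nu_delta)
    (hnu_Delta : 2 * sigma_max * omega <= nu_Delta)
    (hlip_delta : forall i x x', X x -> X x' ->
       enorm (agent_grad g i x - agent_grad g i x') <= nu_delta * enorm (x - x'))
    (hlip_Delta : forall i x x', X x -> X x' ->
       specnorm (agent_gram g i x - agent_gram g i x')
         <= nu_Delta * enorm (x - x'))
    (hnu : nu = Num.max nu_delta nu_Delta)
    (* network and weights *)
    (E : nat -> nat -> rel 'I_nag) (L : nat) (hE : network_connectivity E L)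
    (W : nat -> nat -> 'M[R]_nag) (eta : R) (hW : weight_assumption E eta W)
    (* constants *)
    (L0 : nat) (lam C C1 C2 D : R)
    (hL0 : L0 = ((nag - 1) * L)%N)
    (hlam : lam = (1 - eta ^+ L0) `^ (L0%:R^-1))
    (hC : C = 2 * nag%:R * sigma_max
              * Num.sqrt (nag%:R * (eps_max ^+ 2 + N%:R * sigma_max ^+ 2))
              * ((1 + eta ^- L0) / (1 - eta ^+ L0)))
    (hC1 : C1 = 2 * (1 + sigma_max * eps_max / sigma_min ^+ 2))
    (hC2 : C2 = nag%:R / sigma_min ^+ 2)
    (* numbers of exchanges *)
    (ell : nat -> nat) (ell_min : nat) (lam_inf xi : R)
    (hell_min : is_min [set: nat] ell ell_min)
    (hlam_inf : (\sum_(0 <= k < K.+1) lam ^+ (ell k - ell_min)) @[K --> \oo]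
                --> lam_inf)
    (hxi : 0 < xi < 2^-1)
    (hD : D = C * C2 * (nu * lam_inf * C1 * C2 + 1))
    (hell : ell_min%:Z = Num.ceil (ln (xi / (4 * D)) / ln lam))
    (* algorithm, with a common initial point *)
    (alpha : R) (halpha : 0 < alpha <= 1)
    (xinit : 'I_nag -> 'cV[R]_N) (x0 : 'cV[R]_N) (hx0 : X x0)
    (hinit : forall i, xinit i = x0)
    (x : nat -> 'I_nag -> 'cV[R]_N)
    (hx : x = ggn_iter alpha X g W ell xinit)
    (hinv : forall k i, gossip_H g (W k) (x k) (ell k) i \in unitmx) :
  (forall k i,
     enorm (inexact_descent g (W k) (x k) (ell k) i - exact_descent g (x k i))
       < kappa C1 D lam ell_min)
  /\ (kappa C1 D lam l @[l --> \oo] --> (0 : R)).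
Proof.
have nag_gt0 : (0 < nag)%N by apply: ltn_trans hnag.
have [_ _ L_gt0 _] := hE.
have [/andP[eta_gt0 eta_lt1] _ _ _] := hW.
have /andP[smin_gt0 smin_le] := hsigma.
have smax_gt0 : 0 < sigma_max := lt_le_trans smin_gt0 smin_le.
have eps_ge0 : 0 <= eps_max := le_trans (enorm_ge0 _) (heps _ hx0).
have L0_gt0 : (0 < L0)%N by rewrite hL0 muln_gt0 subn_gt0 hnag L_gt0.
have etaL0_gt0 : 0 < eta ^+ L0 by rewrite exprn_gt0.
have etaL0_lt1 : eta ^+ L0 < 1.
  by rewrite exprn_ilt1 ?(ltW eta_gt0) // -lt0n.
have lamL0 : lam ^+ L0 = 1 - eta ^+ L0.
  by rewrite hlam root_powR // subr_ge0 ltW.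
have lam_gt0 : 0 < lam by rewrite hlam powR_gt0 // subr_gt0.
have lam_lt1 : lam < 1.
  rewrite ltNge; apply/negP => /(exprn_ege1 L0); rewrite lamL0; lra.
have lam01 : 0 < lam < 1 by rewrite lam_gt0.
split; last exact: kappa_cvg0.
have Gmax y v : X y -> enorm (jac g y *m v) <= sigma_max * enorm v.
  by move=> Xy; apply: enorm_mulmx_le => //; exact: (hsmax.2 y Xy).
have Gmin y v : X y ->
    sigma_min ^+ 2 * enorm v <= enorm ((jac g y)^T *m jac g y *m v).
  by move=> Xy; apply: enorm_gram_ge => //; exact: (hsmin.2 y Xy).
have nu_ge0 : 0 <= nu.
  rewrite hnu le_max; apply/orP; left; apply: le_trans hnu_delta.
  by rewrite mulr_ge0 ?addr_ge0 // ltW.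
have grad_lip i y y' : X y -> X y' ->
    enorm (agent_grad g i y - agent_grad g i y') <= nu * enorm (y - y').
  move=> Xy Xy'; apply: le_trans (hlip_delta i _ _ Xy Xy') _.
  by rewrite ler_wpM2r ?enorm_ge0 // hnu le_max lexx.
have gram_lip i y y' v : X y -> X y' ->
    enorm (agent_gram g i y *m v - agent_gram g i y' *m v)
      <= nu * enorm (y - y') * enorm v.
  move=> Xy Xy'; rewrite -mulmxBl.
  apply: le_trans (enorm_mulmx_specnorm _ _ hN) _.
  rewrite ler_wpM2r ?enorm_ge0 //; apply: le_trans (hlip_Delta i _ _ Xy Xy') _.
  by rewrite ler_wpM2r ?enorm_ge0 // hnu le_max lexx orbT.
(* the square root in C dominates both eps_max and sigma_max, the bounds on the
   data being averaged up to the factor sigma_max *)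
set S := Num.sqrt (nag%:R * (eps_max ^+ 2 + N%:R * sigma_max ^+ 2)) in hC.
have nag_ge1 : 1 <= nag%:R :> R by rewrite (ler_nat _ 1).
have N_ge1 : 1 <= N%:R :> R by rewrite (ler_nat _ 1).
have S_ge a : 0 <= a -> a ^+ 2 <= eps_max ^+ 2 + N%:R * sigma_max ^+ 2 -> a <= S.
  move=> a0 aS; rewrite -[leLHS](ger0_norm a0) -sqrtr_sqr.
  apply: ler_wsqrtr; apply: le_trans aS _.
  by rewrite ler_peMl // addr_ge0 ?sqr_ge0 // mulr_ge0 ?sqr_ge0.
have S_eps : eps_max <= S.
  by apply: S_ge => //; rewrite lerDl mulr_ge0 ?sqr_ge0.
have S_smax : sigma_max <= S.
  apply: S_ge; first exact: ltW.
  apply: (le_trans (y := N%:R * sigma_max ^+ 2)); last by rewrite lerDr sqr_ge0.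
  by rewrite ler_peMl ?sqr_ge0.
have S_gt0 : 0 < S := lt_le_trans smax_gt0 S_smax.
pose K := (1 - eta ^+ L0)^-1.
have K_gt0 : 0 < K by rewrite invr_gt0 subr_gt0.
(* 1 + eta^-L0 is at least 2: with the leading 2 of C this leaves a factor 4 to
   be spent on the passage from averages to descent directions *)
have C_ge : 4 * (nag%:R * K * (sigma_max * S)) <= C.
  rewrite hC; have -> : 2 * nag%:R * sigma_max * S
      * ((1 + eta ^- L0) / (1 - eta ^+ L0))
      = (2 * (1 + eta ^- L0)) * (nag%:R * K * (sigma_max * S)).
    by rewrite /K; ring.
  rewrite ler_wpM2r ?mulr_ge0 ?(ltW K_gt0) ?(ltW smax_gt0) ?(ltW S_gt0) //.
  have : 1 <= eta ^- L0 by rewrite invf_ge1 // ltW.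
  lra.
have C_gt0 : 0 < C.
  apply: lt_le_trans C_ge; rewrite !mulr_gt0 // ltr0n //.
have C1_ge0 : 0 <= C1.
  by rewrite hC1 mulr_ge0 // addr_ge0 // divr_ge0 ?sqr_ge0 // mulr_ge0 // ltW.
have C1_gt0 : 0 < C1.
  rewrite hC1 mulr_gt0 // ltr_pwDl // divr_ge0 ?sqr_ge0 // mulr_ge0 // ltW //.
have C2_gt0 : 0 < C2 by rewrite hC2 divr_gt0 ?exprn_gt0 // ltr0n.
have sum_le : forall k, \sum_(0 <= k' < k) lam ^+ (ell k' - ell_min) <= lam_inf.
  by apply: partial_sum_le_lim => // k; rewrite exprn_ge0 // ltW.
have lam_inf_ge0 : 0 <= lam_inf.
  by have := sum_le 0%N; rewrite big_geq.
have D_gt0 : 0 < D.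
  rewrite hD !mulr_gt0 // ltr_wpDl // !mulr_ge0 // ltW //.
have Dlam : D * lam ^+ ell_min.+1 <= 8^-1.
  have /andP[xi_gt0 xi_lt] := hxi.
  have h := expr_le_of_ceil lam01 (divr_gt0 xi_gt0 (mulr_gt0 _ D_gt0)) hell.
  have {}h := h (ltr0Sn R 3).
  have h1 : D * lam ^+ ell_min <= xi / 4.
    have -> : xi / 4 = D * (xi / (4 * D)) by field; exact: lt0r_neq0.
    by rewrite ler_wpM2l // ltW.
  rewrite exprSr mulrA.
  apply: (le_trans (y := D * lam ^+ ell_min * 1)).
    by rewrite ler_wpM2l ?mulr_ge0 ?exprn_ge0 // ?ltW.
  lra.
(* p k bounds the gossip error of update k, r k the disagreement between the
   iterates, which grows by at most 3 C1 C2 p k at update k *)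
pose p k := C / 4 * lam ^+ (ell k).+1.
pose r k := 3 * C1 * C2 * \sum_(0 <= k' < k) p k'.
have p_ge0 k : 0 <= p k.
  by rewrite mulr_ge0 ?exprn_ge0 ?divr_ge0 // ltW.
have r_ge0 k : 0 <= r k.
  by rewrite !mulr_ge0 ?(ltW C2_gt0) // sumr_ge0.
have ell_ge k : (ell_min <= ell k)%N by exact: (hell_min.2 k).
have small k : C2 * (p k + nu * r k) <= D * lam ^+ ell_min.+1.
  have pk : p k <= C / 4 * lam ^+ ell_min.+1.
    rewrite ler_wpM2l ?divr_ge0 // ?(ltW C_gt0) //.
    by apply: ler_wiXn2l; rewrite ?ltnS ?ltW.
  have sp : \sum_(0 <= k' < k) p k' <= C / 4 * lam ^+ ell_min.+1 * lam_inf.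
    rewrite (eq_bigr (fun k' => C / 4 * lam ^+ ell_min.+1
                                * lam ^+ (ell k' - ell_min))) => [|k' _].
      by rewrite -mulr_sumr ler_wpM2l ?mulr_ge0 ?exprn_ge0 ?divr_ge0 // ltW.
    by rewrite /p -[RHS]mulrA -exprD addSn subnKC.
  have rk : nu * r k <= nu * (3 * C1 * C2 * (C / 4 * lam ^+ ell_min.+1 * lam_inf)).
    by rewrite ler_wpM2l // ler_wpM2l // !mulr_ge0 // ltW.
  apply: (le_trans (y := C2 * (C * lam ^+ ell_min.+1
                               * (nu * lam_inf * C1 * C2 + 1)))); last first.
    by rewrite hD le_eqVlt; apply/orP; left; apply/eqP; ring.
  rewrite ler_wpM2l ?(ltW C2_gt0) //; apply: le_trans (lerD pk rk) _.
  set y := C * lam ^+ ell_min.+1; set z := nu * lam_inf * C1 * C2.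
  have y0 : 0 <= y by rewrite mulr_ge0 ?exprn_ge0 // ltW.
  have z0 : 0 <= z by rewrite !mulr_ge0 // ltW.
  have -> : C / 4 * lam ^+ ell_min.+1 = y / 4 by rewrite /y; field.
  have -> : nu * (3 * C1 * C2 * (y / 4 * lam_inf)) = 3 / 4 * (y * z).
    by rewrite /z; field.
  have := mulr_ge0 y0 z0; rewrite mulrDr mulr1; lra.
have dev k (v : 'I_nag -> 'cV[R]_N) b i : (forall j, enorm (v j) <= b) ->
    enorm (gossip (W k) v (ell k) i - nag%:R^-1 *: \sum_j v j)
      <= nag%:R * (lam ^+ (ell k).+1 * K) * b.
  rewrite /K hL0; rewrite hL0 in lamL0 L0_gt0.
  by apply: (network_gossip_deviation k (ell k) i hE hW nag_gt0 _ lamL0 L0_gt0);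
     rewrite lam_gt0 ltW.
have rho_le k a : 0 <= a -> a <= S ->
    nag%:R * (lam ^+ (ell k).+1 * K) * (sigma_max * a) <= p k.
  move=> a0 aS.
  have -> : nag%:R * (lam ^+ (ell k).+1 * K) * (sigma_max * a)
     = nag%:R * K * (sigma_max * a) * lam ^+ (ell k).+1 by ring.
  rewrite ler_wpM2r ?exprn_ge0 ?(ltW lam_gt0) // ler_pdivlMr // mulrC.
  apply: le_trans C_ge; rewrite ler_wpM2l // ler_wpM2l ?mulr_ge0 ?(ltW K_gt0) //.
  by rewrite ler_wpM2l // ltW.
have rho_grad k := rho_le k _ eps_ge0 S_eps.
have rho_gram k : nag%:R * (lam ^+ (ell k).+1 * K) * sigma_max ^+ 2 <= p k.
  by rewrite expr2; apply: rho_le => //; exact: ltW.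
have small8 k : nag%:R / sigma_min ^+ 2 * (p k + nu * r k) <= 8^-1.
  by rewrite -hC2; exact: le_trans (small k) Dlam.
have error k Xk rk := inexact_descent_error nag_gt0 hgdiff heps smin_gt0
  (ltW smax_gt0) nu_ge0 Gmax Gmin grad_lip gram_lip Xk rk (dev k)
  (rho_grad k) (rho_gram k) (p_ge0 k) (r_ge0 k) (small8 k) (hinv k).
have disagreement k Xk rk := inexact_descent_disagreement nag_gt0 hgdiff heps smin_gt0
  (ltW smax_gt0) nu_ge0 Gmax Gmin grad_lip gram_lip Xk rk (dev k)
  (rho_grad k) (rho_gram k) (p_ge0 k) (r_ge0 k) (small8 k) (hinv k).
have X0 : X !=set0 by exists x0.
have invariant k : (forall i, X (x k i)) /\
    (forall i j, enorm (x k i - x k j) <= r k).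
  elim: k => [|k [Xk rk]].
    split=> [i|i j]; rewrite hx /= !hinit //.
    by rewrite subrr enorm0 r_ge0.
  have xS i : x k.+1 i = Defs.proj X
      (x k i - alpha *: inexact_descent g (W k) (x k) (ell k) i).
    by rewrite hx.
  split=> [i|i j]; rewrite !xS; first exact: proj_in.
  apply: le_trans (proj_nonexpansive hXcompact hXconvex X0 _ _) _.
  set di := inexact_descent _ _ _ _ i; set dj := inexact_descent _ _ _ _ j.
  have -> : x k i - alpha *: di - (x k j - alpha *: dj)
      = (x k i - x k j) - alpha *: (di - dj).
    by apply/colP => a; rewrite !mxE; ring.
  apply: le_trans (enormB _ _) _; rewrite /r big_nat_recr //= mulrDr.
  apply: lerD; first exact: rk.
  have /andP[al0 al1] := halpha.
  rewrite enormZ gtr0_norm //; apply: (le_trans (y := 1 * enorm (di - dj))).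
    by rewrite ler_wpM2r ?enorm_ge0.
  rewrite mul1r; have := disagreement k Xk rk i j.
  by rewrite -hC1 -hC2.
move=> k i; have [Xk rk] := invariant k.
have := error k Xk rk i; rewrite -hC1 -hC2 => /le_lt_trans; apply.
rewrite /kappa -mulrA; apply: (le_lt_trans (y := C1 * (D * lam ^+ ell_min.+1))).
  by rewrite ler_wpM2l.
have : 0 < C1 * (D * lam ^+ ell_min.+1) by rewrite !mulr_gt0 ?exprn_gt0.
by rewrite -!mulrA; lra.
Qed.
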